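(* Let $n \geq 2$ and let $V = (V_1,\ldots,V_n)$ be a $\mathcal{U}_n$-twisted isometry on a Hilbert space $\mathcal{H}$. For $A \subseteq I_n = \{1,\ldots,n\}$ set $$\mathcal{H}_A = \bigoplus_{k \in \mathbb{Z}_+^{|A|}} V_A^k \Big( \bigcap_{l \in \mathbb{Z}_+^{n - |A|}} V_{I_n \setminus A}^l \mathcal{W}_A\Big).$$ Then $V$ admits the orthogonal decomposition $\mathcal{H} = \bigoplus_{A \subseteq I_n} \mathcal{H}_A$; that is: (i) $\mathcal{H}_A$ is a closed subspace reducing $V_i$ for all $i=1,\ldots,n$ and all $A \subseteq I_n$; (ii) $\mathcal{H} = \bigoplus_{A \subseteq I_n} \mathcal{H}_A$ (orthogonal direct sum); and (iii) for each $A \subseteq I_n$, $V_i|_{\mathcal{H}_A}$ is a shift for every $i \in A$ and $V_j|_{\mathcal{H}_A}$ is a unitary for every $j \in A^c = I_n\setminus A$.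
   Context: All Hilbert spaces are complex and separable; some of the subspaces $\mathcal{H}_A$ may be $\{0\}$. An isometry $T$ on a Hilbert space is a shift if $T^{*m} \to 0$ in the strong operator topology. A closed subspace reduces an operator $T$ if it is invariant under $T$ and $T^*$. $\mathcal{U}_n$-twisted isometry: let $\{U_{ij}\}_{1 \leq i<j\leq n}$ be commuting unitaries on $\mathcal{H}$ and put $U_{ji} := U_{ij}^*$ for $i<j$. An $n$-tuple of isometries $(V_1,\ldots,V_n)$ on $\mathcal{H}$ is a $\mathcal{U}_n$-twisted isometry with respect to $\{U_{ij}\}_{i<j}$ if $V_i^*V_j=U_{ij}^*V_jV_i^*$ and $V_kU_{ij}=U_{ij}V_k$ for all $i,j,k\in\{1,\ldots,n\}$ with $i \neq j$. When the unitaries are not mentioned, they are assumed to exist. Notation: for $A = \{i_1 < \cdots < i_m\} \subseteq I_n$ and $k \in \mathbb{Z}_+^m$ (where $\mathbb{Z}_+=\{0,1,2,\ldots\}$), $V_A^k = V_{i_1}^{k_1}\cdots V_{i_m}^{k_m}$; and $\mathcal{W}_A = \bigcap_{i\in A}\ker V_i^*$ for $A \neq \emptyset$, $\mathcal{W}_\emptyset = \mathcal{H}$. For the empty index set there is exactly one term and $V_\emptyset^k = I$; thus $\mathcal{H}_\emptyset = \bigcap_{l \in \mathbb{Z}_+^n} V^l\mathcal{H}$ and $\mathcal{H}_{I_n} = \bigoplus_{k\in\mathbb{Z}_+^n} V^k \mathcal{W}_{I_n}$. *)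

(* Defs.v *)
From HB Require Import structures.
From mathcomp Require Import all_boot all_order all_algebra sesquilinear.
From mathcomp Require Import finmap complex.
From mathcomp Require Import all_classical all_reals all_analysis.
From mathcomp.analysis.showcase Require Import summability.

Set Implicit Arguments.
Unset Strict Implicit.
Unset Printing Implicit Defensive.

Import Order.TTheory GRing.Theory Num.Theory Num.Def.
Import numFieldNormedType.Exports.

Local Open Scope classical_set_scope.
Local Open Scope complex_scope.
Local Open Scope ring_scope.

(* [inner] is linear in its first argument and conjugate linear in the second. *)
HB.mixin Record isHilbert (R : realType) H
    of CompleteNormedModule R[i] H := {
  inner : {dot H for @conjC R[i]} ;
  inner_norm : forall x : H, inner x x = `|x| ^+ 2
}.

#[short(type="hilbertType")]
HB.structure Definition Hilbert (R : realType) :=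
  {H of CompleteNormedModule R[i] H & isHilbert R H}.

Local Notation "''[' x , y ]" := (inner x y) : ring_scope.

Definition separable (T : topologicalType) :=
  exists D : set T, countable D /\ dense D.

Section Operators.
Context {R : realType} {H : hilbertType R}.
Implicit Types (M : set H) (T : H -> H) (L : {linear H -> H}).

Definition closed_subspace M := submod_closed (mem M) /\ closed M.

(* Operators on a closed subspace M, itself viewed as a Hilbert space, are given
   by maps on H of which only the restriction to M matters.  The adjoint below
   is that of T|_M : M -> M : its value at y is the unique z in M such that
   <T x, y> = <x, z> for all x in M.  By the Riesz representation theorem, such
   a z exists whenever M is a closed subspace and T|_M is a bounded operator. *)
Definition adjoint_on M T (y : H) : H :=
  xget 0 [set z | M z /\ forall x, M x -> '[T x, y] = '[x, z]].

Definition adjoint T := adjoint_on setT T.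

Definition isometry_on M L :=
  forall x, M x -> M (L x) /\ `|L x| = `|x|.

Definition shift_on M L :=
  isometry_on M L /\
  forall x, M x -> iter m (adjoint_on M L) x @[m --> \oo] --> (0 : H).

Definition unitary_on M L :=
  [/\ forall x, M x -> M (L x), {within M, continuous L},
      forall x, M x -> adjoint_on M L (L x) = x &
      forall x, M x -> L (adjoint_on M L x) = x].

Definition isometry L := isometry_on setT L.

Definition unitary L := unitary_on setT L.

Definition reduces M T :=
  forall x, M x -> M (T x) /\ M (adjoint T x).

(* The sums of the unconditionally convergent families (x_ i) with x_ i in M i. *)
Definition hilbert_sum (I : choiceType) (M : I -> set H) : set H :=
  [set x | exists x_ : I -> H,
     (forall i, M i (x_ i)) /\ partial_sum x_ @ totally --> x].

Definition orthogonal_family (I : choiceType) (M : I -> set H) :=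
  (forall i, closed_subspace (M i)) /\
  (forall i j, i != j -> forall x y, M i x -> M j y -> '[x, y] = 0).

End Operators.

Section Twisted.
Context {R : realType} {H : hilbertType R} {n : nat}.
Implicit Types (U : 'I_n -> 'I_n -> {linear H -> H}) (V : 'I_n -> {linear H -> H}).
Implicit Types (A : {set 'I_n}).

(* Only the values U i j with i < j are used. *)
Definition twist U (i j : 'I_n) : H -> H :=
  if (i < j)%N then (U i j : H -> H) else adjoint (U j i).

Definition twisted_isometry_wrt U V :=
  [/\ forall i j : 'I_n, (i < j)%N -> unitary (U i j),
      forall i j k l : 'I_n, (i < j)%N -> (k < l)%N ->
        U i j \o U k l =1 U k l \o U i j,
      forall i, isometry (V i),
      forall i j : 'I_n, i != j ->
        adjoint (V i) \o V j =1 adjoint (twist U i j) \o V j \o adjoint (V i) &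
      forall i j k : 'I_n, i != j ->
        V k \o twist U i j =1 twist U i j \o V k].

Definition twisted_isometry V := exists U, twisted_isometry_wrt U V.

(* enum_val lists the elements of A in increasing order. *)
Definition mpow V A (k : {ffun 'I_#|A| -> nat}) : H -> H :=
  \big[comp/id]_(j < #|A|) iter (k j) (V (enum_val j)).

Definition wandering V A : set H :=
  \bigcap_(i in [set` A]) [set x | adjoint (V i) x = 0].

Definition summand V A (k : {ffun 'I_#|A| -> nat}) : set H :=
  mpow V k @`
    \bigcap_(l in [set: {ffun 'I_#|~: A| -> nat}]) (mpow V l @` wandering V A).

Definition HA V A : set H := hilbert_sum (@summand V A).

End Twisted.

(* Main.v *)
From mathcomp Require Import all_boot all_order all_algebra.
From mathcomp Require Import finmap complex.
From mathcomp Require Import all_classical all_reals all_analysis.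
From mathcomp.analysis.showcase Require Import summability.
From mathcomp Require Import ring lra.
Require Import Defs.

(** The theorem is a Wold decomposition carried out simultaneously for all the
    [V i].  For one isometry [L], the space splits orthogonally into the shift
    part, the [x] with [L^*m x --> 0], and the unitary part, the [x] in the range
    of every [L^m] ([wold_decomposition]).  The shift part is generated by the
    levels, the images of [ker L^*] under the powers [L^m].

    The twisted relations say that, for [i != j], both [V j] and its adjoint
    commute with [V i] and its adjoint up to unitaries which commute
    with all the [V k].  Consequently they map the range of each power of [V i] into
    itself and do not increase the norms of the [(V i)^*m x], so that they
    preserve the two parts and all the levels of [V i] ([compatible_isometry],
    [compatible_adjoint]).

    Two descriptions follow.  The summand indexed by [A] and [k] consists of the
    vectors that lie at level [k i] of [V i] for [i] in [A], and in the unitary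
    part of [V i] for [i] outside [A] ([summandE]).  The space [HA V A] consists of
    the vectors in the shift part of [V i] for [i] in [A], and in the unitary part
    of [V i] for [i] outside [A] ([HAE]).  From the latter, [HA V A] is closed and
    reduces every [V i], and the [V i] act on it as shifts or unitaries.  It is
    also clear that the [HA V A] are pairwise orthogonal.

    It remains to see that there are enough summands, for [HAE] and for the
    decomposition of the whole space.  An orthogonal family of closed subspaces
    sums to the smallest closed subspace containing it ([hilbert_sum_closed],
    [sub_hilbert_sum], [hilbert_sum_min]), so it is enough to approximate.  This is
    done one index at a time: the components of [x] relative to [V i] are limits of
    vectors [V i^m V i^*m x], hence stay in every closed subspace that reduces
    [V i] ([reducing_range_projection]).  The steps already made for the other
    indices are therefore not spoilt.

    The adjoints are defined by a choice with a default value.  That they exist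
    follows from the projection theorem ([nearest_point],
    [orthogonal_projection]) and Riesz representation ([adjoint_exists]). *)

Set Implicit Arguments.
Unset Strict Implicit.
Unset Printing Implicit Defensive.

Import Order.TTheory GRing.Theory Num.Theory Num.Def.
Import numFieldNormedType.Exports.

Local Open Scope classical_set_scope.
Local Open Scope complex_scope.
Local Open Scope ring_scope.

Local Notation "''[' x , y ]" := (inner x y) : ring_scope.

(** * Inner products, closed subspaces and the projection theorem *)

Section InnerProduct.
Context {R : realType} {H : hilbertType R}.
Implicit Types (x y z : H) (a : R[i]).

Lemma innerC x y : '[x, y] = ('[y, x])^*.
Proof. by rewrite hermC expr0 mul1r. Qed.

Lemma innerDl x y z : '[x + y, z] = '[x, z] + '[y, z].
Proof. exact: linearDl. Qed.
Lemma innerBl x y z : '[x - y, z] = '[x, z] - '[y, z].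
Proof. exact: linearBl. Qed.
Lemma innerZl a x y : '[a *: x, y] = a * '[x, y].
Proof. exact: linearZl_LR. Qed.
Lemma innerDr x y z : '[x, y + z] = '[x, y] + '[x, z].
Proof. exact: linearDr. Qed.
Lemma innerBr x y z : '[x, y - z] = '[x, y] - '[x, z].
Proof. exact: linearBr. Qed.
Lemma innerZr a x y : '[x, a *: y] = a^* * '[x, y].
Proof. exact: linearZr_LR. Qed.
Lemma inner0l y : '[0, y] = 0.
Proof. exact: linear0l. Qed.
Lemma inner0r y : '[y, 0] = 0.
Proof. exact: linear0r. Qed.

Lemma inner_eq0C x y : '[x, y] = 0 -> '[y, x] = 0.
Proof. by rewrite innerC => /eqP; rewrite conjc_eq0 => /eqP. Qed.

Lemma inner_inj x y : (forall z, '[z, x] = '[z, y]) -> x = y.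
Proof.
move=> /(_ (x - y)) /eqP; rewrite -subr_eq0 -innerBr inner_norm.
by rewrite sqrf_eq0 normr_eq0 subr_eq0 => /eqP.
Qed.

Lemma pythagoras x y : '[x, y] = 0 -> `|x + y| ^+ 2 = `|x| ^+ 2 + `|y| ^+ 2.
Proof.
move=> xy; rewrite -!inner_norm innerDl !innerDr xy (inner_eq0C xy).
by rewrite addr0 add0r.
Qed.

Lemma parallelogram x y :
  `|x + y| ^+ 2 + `|x - y| ^+ 2 = 2 * (`|x| ^+ 2 + `|y| ^+ 2).
Proof.
rewrite -!inner_norm innerBl !innerBr innerDl !innerDr; ring.
Qed.

Lemma cauchy_schwarz x y : `|'[x, y]| <= `|x| * `|y|.
Proof.
have [->|y0] := eqVneq y 0; first by rewrite inner0r !normr0 mulr0.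
have n0 : `|y| != 0 by rewrite normr_eq0.
pose a := '[x, y] / `|y| ^+ 2.
have xy : '[x - a *: y, a *: y] = 0.
  by rewrite innerZr innerBl innerZl inner_norm /a divfK ?subrr ?mulr0 ?sqrf_eq0.
have := pythagoras xy; rewrite subrK => e.
have : `|a *: y| ^+ 2 <= `|x| ^+ 2 by rewrite e lerDr exprn_ge0.
rewrite ler_sqr ?nnegrE// normrZ /a normrM normfV normrX normr_id.
by rewrite expr2 invfM mulrA mulfVK// ler_pdivrMr// normr_gt0.
Qed.

Lemma norm_cvg {T : Type} (F : set_system T) {FF : Filter F} (f : T -> H) x :
  (forall e : R[i], 0 < e -> \forall t \near F, `|f t - x| < e) -> f @ F --> x.
Proof.
move=> h; apply/cvgrPdist_lt => e e0; near=> t; rewrite distrC; near: t; exact: h.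
Unshelve. all: by end_near. Qed.

Lemma cvg_norm_lt {T : Type} (F : set_system T) {FF : Filter F} (f : T -> H) x
    (e : R[i]) :
  f @ F --> x -> 0 < e -> \forall t \near F, `|f t - x| < e.
Proof.
move=> /cvgrPdist_lt h e0; near=> t; rewrite distrC; near: t; exact: h.
Unshelve. all: by end_near. Qed.

Lemma closed_approx (M : set H) x : closed M ->
  (forall e : R[i], 0 < e -> exists2 y, M y & `|x - y| < e) -> M x.
Proof.
move=> cM h; apply: cM => B /nbhs_ballP[e /= e0 eB].
have [y My xy] := h e e0; exists y; split => //; apply: eB.
by rewrite -ball_normE.
Qed.

End InnerProduct.

Section Projection.
Context {R : realType} {H : hilbertType R}.
Implicit Types (x y z : H) (M : set H).

Lemma closed_subspaceE M : closed_subspace M <->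
  [/\ M 0, forall a x y, M x -> M y -> M (a *: x + y) & closed M].
Proof.
split=> [[[M0 ML] cM]|[M0 ML cM]]; split => //.
- by rewrite inE in M0.
- by move=> a x y Mx My; have := ML a x y; rewrite !inE; apply.
- by split=> [|a x y]; rewrite !inE => // *; apply: ML.
Qed.

Section Subspace.
Variable M : set H.
Hypothesis cM : closed_subspace M.

Lemma subspace0 : M 0.
Proof. by have [] := (closed_subspaceE M).1 cM. Qed.
Lemma subspaceD x y : M x -> M y -> M (x + y).
Proof.
by have [_ ML _] := (closed_subspaceE M).1 cM; move=> /(ML 1); rewrite scale1r; apply.
Qed.
Lemma subspaceZ (a : R[i]) x : M x -> M (a *: x).
Proof.
have [M0 ML _] := (closed_subspaceE M).1 cM.
by move=> Mx; rewrite -[_ *: _]addr0; exact: ML.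
Qed.
Lemma subspaceB x y : M x -> M y -> M (x - y).
Proof. by move=> Mx My; apply: subspaceD => //; rewrite -scaleN1r; exact: subspaceZ. Qed.
Lemma subspace_sum I (r : seq I) (P : pred I) (f : I -> H) :
  (forall i, P i -> M (f i)) -> M (\sum_(i <- r | P i) f i).
Proof.
by move=> h; elim/big_rec: _ => [|i x Pi]; [exact: subspace0|exact/subspaceD/h].
Qed.
Lemma subspace_cvg {T : Type} (F : set_system T) {FF : ProperFilter F} (f : T -> H) x :
  f @ F --> x -> (\forall t \near F, M (f t)) -> M x.
Proof.
by move=> fx Mf; apply: (closed_cvg M) fx => //; have [] := (closed_subspaceE M).1 cM.
Qed.
Lemma subspace_approx x :
  (forall e : R[i], 0 < e -> exists2 y, M y & `|x - y| < e) -> M x.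
Proof. by apply: closed_approx; case: cM. Qed.

End Subspace.

Lemma gt0_complexE (e : R[i]) : 0 < e -> e = (complex.Re e)%:C /\ 0 < complex.Re e.
Proof.
by rewrite ltcE /= => /andP[/eqP ime e0]; split => //; case: e ime {e0} => a b /= ->.
Qed.

(** A nearest point of [M] exists: by the parallelogram law the points of [M]
    whose squared distance to [x] is within [e] of the infimum form a set of
    diameter at most [2 * sqrt e], so that these sets generate a Cauchy filter. *)
Lemma nearest_point M x : closed_subspace M ->
  exists2 p, M p & forall w, M w -> `|x - p| <= `|x - w|.
Proof.
move=> cM; pose q m := complex.Re (`|x - m| ^+ 2).
have qE m : `|x - m| ^+ 2 = (q m)%:C.
  by rewrite /q RRe_real// ger0_real// exprn_ge0.
have q0 m : 0 <= q m by rewrite -ler0c -qE exprn_ge0.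
pose E := [set q m | m in M]; pose d := inf E.
have lbE : has_lbound E by exists 0 => _ [m _ <-].
have infE : has_inf E by split => //; exists (q 0), 0 => //; exact: subspace0.
have dq m : M m -> d <= q m by move=> Mm; apply: ge_inf => //; exists m.
pose B (e : R) := [set m | M m /\ q m < d + e].
have B0 e : 0 < e -> B e !=set0.
  by move=> e0; have [_ [m Mm <-] qm] := inf_adherent e0 infE; exists m.
have diam e m m' : B e m -> B e m' -> `|m - m'| ^+ 2 <= (4 * e)%:C.
  move=> [Mm qm] [Mm' qm'].
  (* the midpoint of [m] and [m'] is in [M], hence no closer to [x] than [d] *)
  pose c : H := (2^-1 : R[i]) *: (m + m').
  have Mc : M c by apply: subspaceZ => //; exact: subspaceD.
  have := parallelogram (x - m') (x - m).
  have -> : x - m' - (x - m) = m - m' by rewrite opprB addrC subrKA.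
  have -> : x - m' + (x - m) = (2 : R[i]) *: (x - c).
    rewrite scalerBr /c scalerA divff ?pnatr_eq0// scale1r scaler_nat mulr2n.
    by rewrite addrACA -opprD (addrC m').
  rewrite normrZ exprMn !qE => /(canRL (addKr _)) ->.
  rewrite normr_nat -natrX -!(rmorph_nat (real_complex R)) -!rmorphD -!rmorphM.
  rewrite addrC -rmorphB lecR.
  have := dq _ Mc; lra.
pose F := filter_from [set e : R | 0 < e] B.
have FF : ProperFilter F.
  apply: filter_from_proper; last exact: B0.
  apply: filter_from_filter; first by exists 1 => /=.
  move=> e e' e0 e'0; exists (Num.min e e') => /=; first by rewrite lt_min e0.
  by move=> m [Mm]; rewrite -ltrBlDl lt_min !ltrBlDl => /andP[? ?].
have cF : cvg F.
  apply: cauchy_cvg; apply: cauchy_exP => e ep; have [eE e0] := gt0_complexE ep.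
  have e'0 : 0 < (complex.Re e / 4) ^+ 2 by rewrite exprn_gt0// divr_gt0.
  have [m Bm] := B0 _ e'0.
  exists m, ((complex.Re e / 4) ^+ 2) => // m' Bm'; rewrite -ball_normE /=.
  rewrite -ltr_sqr ?nnegrE ?normr_ge0// ?ltW//.
  apply: le_lt_trans (diam _ _ _ Bm Bm') _.
  rewrite [in ltRHS]eE -rmorphXn ltcR; nra.
have [p Fp] := (cvg_ex _).1 cF.
exists p => [|w Mw].
  by apply: (@subspace_cvg M cM H F _ id p Fp); exists 1 => //= m [].
apply/ler_addgt0Pr => e ep; have [eE e0] := gt0_complexE ep.
have : \forall m \near F, B ((complex.Re e / 2) ^+ 2) m /\ `|m - p| < e / 2.
  apply: filterI.
    by exists ((complex.Re e / 2) ^+ 2) => //=; rewrite exprn_gt0// divr_gt0.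
  by apply: (@cvg_norm_lt _ _ H F _ id p _ Fp); rewrite divr_gt0.
move=> /filter_ex[m [[Mm qm] mp]].
rewrite -(subrKA m) [in leRHS](splitr e) [in leRHS]addrA.
apply: le_trans (ler_normD _ _) _; apply: lerD; last exact: ltW.
have e20 : 0 <= e / 2 by rewrite divr_ge0// ltW.
rewrite -ler_sqr ?nnegrE ?addr_ge0// sqrrD !qE.
apply: (@le_trans _ _ (q w + (complex.Re e / 2) ^+ 2)%:C).
  by rewrite lecR; apply: ltW (lt_le_trans qm _); rewrite lerD2r dq.
rewrite rmorphD lerD//.
  by rewrite lerDl mulrn_wge0// mulr_ge0.
by rewrite [in leRHS]eE -(rmorph_nat (real_complex R)) -fmorphV -rmorphM -rmorphXn.
Qed.

(** A component of [x - p] along [v] could be subtracted to bring the nearest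
    point [p] closer to [x]. *)
Lemma orthogonal_projection M x : closed_subspace M ->
  exists2 p, M p & forall v, M v -> '[x - p, v] = 0.
Proof.
move=> cM; have [p Mp pmin] := nearest_point x cM.
exists p => // v Mv.
have [->|v0] := eqVneq v 0; first by rewrite inner0r.
have n0 : `|v| != 0 by rewrite normr_eq0.
pose a := '[x - p, v] / `|v| ^+ 2.
have Ma : M (a *: v) by exact: subspaceZ.
have xv : '[x - p - a *: v, a *: v] = 0.
  by rewrite innerZr innerBl innerZl inner_norm /a divfK ?subrr ?mulr0 ?sqrf_eq0.
have := pmin _ (subspaceD cM Mp Ma).
rewrite -ler_sqr ?nnegrE// opprD addrA.
have := pythagoras xv; rewrite subrK => ->.
rewrite gerDl => av.
have : `|a *: v| ^+ 2 == 0 by rewrite eq_le av exprn_ge0.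
rewrite sqrf_eq0 normr_eq0 scaler_eq0 (negbTE v0) orbF mulf_eq0 invr_eq0.
by rewrite sqrf_eq0 (negbTE n0) orbF => /eqP.
Qed.

End Projection.

(** * Linear contractions and adjoints *)

Section Contractions.
Context {R : realType} {H : hilbertType R}.
Implicit Types (x y z : H) (M : set H) (S T : H -> H).

(** Linearity is part of the notion since adjoints and their iterates are bare
    functions, without a linear structure to be inferred. *)
Definition contraction T :=
  (forall (a : R[i]) x y, T (a *: x + y) = a *: T x + T y) /\
  (forall x, `|T x| <= `|x|).

Lemma contraction0 T (cT : contraction T) : T 0 = 0.
Proof.
apply/eqP; rewrite -normr_eq0 eq_le normr_ge0 andbT.
by apply: le_trans (cT.2 _) _; rewrite normr0.
Qed.
Lemma contractionD T (cT : contraction T) x y : T (x + y) = T x + T y.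
Proof. by rewrite -[x]scale1r cT.1 !scale1r. Qed.
Lemma contractionZ T (cT : contraction T) (a : R[i]) x : T (a *: x) = a *: T x.
Proof. by rewrite -[a *: x]addr0 cT.1 (contraction0 cT) addr0. Qed.
Lemma contractionB T (cT : contraction T) x y : T (x - y) = T x - T y.
Proof. by rewrite -scaleN1r (contractionD cT) (contractionZ cT) scaleN1r. Qed.

Lemma contractionN T (cT : contraction T) x : T (- x) = - T x.
Proof. by rewrite -scaleN1r (contractionZ cT) scaleN1r. Qed.

Lemma contraction_comp S T : contraction S -> contraction T -> contraction (S \o T).
Proof.
move=> [lS cS] [lT cT]; split => [a x y|x] /=; first by rewrite lT lS.
exact: le_trans (cS _) (cT _).
Qed.
Lemma contraction_id : contraction id.
Proof. by []. Qed.
Lemma contraction_iter T m : contraction T -> contraction (iter m T).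
Proof.
by move=> cT; elim: m => [|m]; [exact: contraction_id|exact: contraction_comp].
Qed.
Lemma contraction_zero : contraction (fun=> 0 : H).
Proof. by split=> [a x y|x]; rewrite ?normr0 ?normr_ge0// scaler0 addr0. Qed.

Lemma closed_subspace_eq S T : contraction S -> contraction T ->
  closed_subspace [set x | S x = T x].
Proof.
move=> cS cT; apply/closed_subspaceE; split.
- by rewrite /= (contraction0 cS) (contraction0 cT).
- by move=> a x y /= Sx Sy; rewrite cS.1 cT.1 Sx Sy.
move=> x xc; apply/eqP; rewrite -subr_eq0 -normr_le0.
apply/ler_addgt0Pr => e e0; rewrite add0r.
have e20 : 0 < e / 2 by rewrite divr_gt0.
have [y [/= Sy]] := xc _ (nbhsx_ballx x _ e20).
rewrite -ball_normE /= => /ltW xy.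
have -> : S x - T x = S (x - y) - T (x - y).
  by rewrite (contractionB cS) (contractionB cT) Sy opprB subrKA.
apply: le_trans (ler_normB _ _) _; rewrite (splitr e); apply: lerD.
  exact: le_trans (cS.2 _) xy.
exact: le_trans (cT.2 _) xy.
Qed.

Lemma closed_subspaceI (I : Type) (M : I -> set H) :
  (forall i, closed_subspace (M i)) -> closed_subspace [set x | forall i, M i x].
Proof.
move=> cM; apply/closed_subspaceE; split.
- by move=> i; exact: subspace0 (cM i).
- move=> a x y Mx My i; apply: subspaceD (cM i) _ _ _ (My i).
  exact: subspaceZ (cM i) _ _ (Mx i).
move=> x xc i; have [_ cMi] := cM i; apply: cMi.
by apply: closure_subset xc => y; apply.
Qed.

Lemma closed_subspaceI2 M M' : closed_subspace M -> closed_subspace M' ->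
  closed_subspace (M `&` M').
Proof.
move=> cM cM'.
have -> : M `&` M' = [set x | forall b : bool, (if b then M else M') x].
  apply/seteqP; split => [x [? ?] []//|x h].
  by split; [exact: (h true)|exact: (h false)].
by apply: closed_subspaceI => -[].
Qed.

(** The operators being uniformly bounded, convergence to [0] passes to the limit
    in [x].  Both the shift part of an isometry and the sum of an orthogonal
    family are of this form. *)
Lemma closed_subspace_cvg0 (I : Type) (F : set_system I) {FF : Filter F}
    (T : I -> H -> H) : (forall i, contraction (T i)) ->
  closed_subspace [set x | T i x @[i --> F] --> (0 : H)].
Proof.
move=> cT; apply/closed_subspaceE; split.
- rewrite /= (_ : (fun i => _) = fun=> 0); first exact: cvg_cst.
  by apply: funext => i; exact: contraction0.
- move=> a x y /= Tx Ty.
  rewrite (_ : (fun i => _) = (fun i => a *: T i x + T i y)); last first.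
    by apply: funext => i; exact: (cT i).1.
  by rewrite -[0]addr0 -[X in X + 0](scaler0 _ a); apply: cvgD => //; exact: cvgZr.
move=> x xc; apply: norm_cvg => e e0.
have e20 : 0 < e / 2 by rewrite divr_gt0.
have [y [/= Ty]] := xc _ (nbhsx_ballx x _ e20).
rewrite -ball_normE /= => xy.
near=> i; rewrite subr0 -[x](subrK y) (contractionD (cT i)).
apply: le_lt_trans (ler_normD _ _) _; rewrite (splitr e); apply: ltrD.
  exact: le_lt_trans ((cT i).2 _) xy.
rewrite -[T i y]subr0; near: i; exact: cvg_norm_lt.
Unshelve. all: by end_near. Qed.

End Contractions.

Section Adjoints.
Context {R : realType} {H : hilbertType R}.
Implicit Types (x y z : H) (M : set H) (T : H -> H) (L : {linear H -> H}).

(** Riesz representation: if [w] is orthogonal to the kernel [K] of the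
    functional [f : x |-> <T x, y>], then [f w *: x - f x *: w] lies in [K], so
    that [f x] is proportional to [<x, w>]. *)
Lemma adjoint_exists T y : contraction T -> exists z, forall x, '[T x, y] = '[x, z].
Proof.
move=> cT.
pose K : set H := [set x | '[T x, y] = 0].
have cK : closed_subspace K.
  apply/closed_subspaceE; split.
  - by rewrite /K /= (contraction0 cT) inner0l.
  - by move=> a u v /= Ku Kv; rewrite /K /= cT.1 innerDl innerZl Ku Kv mulr0 addr0.
  move=> x xc; apply/eqP; rewrite -normr_le0; apply/ler_addgt0Pr => e e0.
  have y0 : 0 < `|y| + 1 by rewrite ltr_wpDl.
  have [k [/= Kk]] := xc _ (nbhsx_ballx x _ (divr_gt0 e0 y0)).
  rewrite -ball_normE /= add0r ltr_pdivlMr// => xk.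
  rewrite -[x](subrK k) (contractionD cT) innerDl Kk addr0.
  apply: le_trans (cauchy_schwarz _ _) _; apply: le_trans (ltW xk).
  by apply: ler_pM => //; [exact: cT.2|rewrite lerDl].
have [Kx|/existsNP[x0 Kx0]] := pselect (forall x, K x).
  by exists 0 => x; rewrite inner0r; exact: Kx.
have [p Kp pK] := orthogonal_projection x0 cK.
set w := x0 - p in pK.
have w0 : `|w| ^+ 2 != 0.
  rewrite sqrf_eq0 normr_eq0; apply: contra_notN Kx0.
  by rewrite /w subr_eq0 => /eqP ->.
exists ((('[T w, y])^* / `|w| ^+ 2) *: w) => x.
have : K ('[T w, y] *: x - '[T x, y] *: w).
  rewrite /K /= (contractionB cT) !(contractionZ cT) innerBl !innerZl.
  by rewrite mulrC subrr.
move=> /pK/inner_eq0C; rewrite innerBl !innerZl inner_norm => /eqP.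
rewrite subr_eq0 innerZr rmorphM /= fmorphV /= conjCK.
rewrite (CrealP (ger0_real _)) ?exprn_ge0// mulrAC => /eqP ->.
by rewrite mulfK.
Qed.

Lemma adjoint_on_unique M T y z : M z -> (forall x, M x -> '[T x, y] = '[x, z]) ->
  adjoint_on M T y = z.
Proof.
move=> Mz hz; apply: xget_unique => // z' [Mz' hz'].
have e x : M x -> '[x, z' - z] = 0 by move=> Mx; rewrite innerBr -hz// -hz'// subrr.
have := inner_norm (z' - z); rewrite innerBl !e// subrr => /esym/eqP.
by rewrite sqrf_eq0 normr_eq0 subr_eq0 => /eqP.
Qed.

Lemma adjointE T x y : contraction T -> '[T x, y] = '[x, adjoint T y].
Proof.
move=> /(adjoint_exists y)[z hz].
by rewrite /adjoint (@adjoint_on_unique setT T y z).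
Qed.

Lemma adjointEr T x y : contraction T -> '[x, T y] = '[adjoint T x, y].
Proof. by move=> cT; rewrite innerC adjointE// -innerC. Qed.

Lemma adjoint_contraction T : contraction T -> contraction (adjoint T).
Proof.
move=> cT; split => [a x y|x].
  by apply: inner_inj => z; rewrite -adjointE// !innerDr !innerZr !adjointE.
have [->|n0] := eqVneq (adjoint T x) 0; first by rewrite normr0.
have n1 : 0 < `|adjoint T x| by rewrite normr_gt0.
rewrite -(ler_pM2l n1) -expr2 -inner_norm -adjointE//.
rewrite -[X in X <= _]ger0_norm; last by rewrite adjointE// inner_norm exprn_ge0.
by apply: le_trans (cauchy_schwarz _ _) _; rewrite ler_wpM2r// cT.2.
Qed.

Lemma adjoint_on_reducing M T y : contraction T -> reduces M T -> M y ->
  adjoint_on M T y = adjoint T y.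
Proof.
move=> cT rM My; apply: adjoint_on_unique => [|x Mx]; first by have [] := rM _ My.
exact: adjointE.
Qed.

Lemma isometry_norm L : isometry L -> forall x, `|L x| = `|x|.
Proof. by move=> iL x; have [] := iL x I. Qed.

Lemma isometry_contraction L : isometry L -> contraction L.
Proof. by move=> iL; split => [a x y|x]; rewrite ?linearP// isometry_norm. Qed.

(** Polarization: [d := <L x, L y> - <x, y>] satisfies [a^* * d + a * d^* = 0] for
    every scalar [a]; the choice [a = d] gives [d = 0]. *)
Lemma isometry_inner L x y : isometry L -> '[L x, L y] = '[x, y].
Proof.
move=> iL; have [d dE] : exists d, '[L x, L y] = '[x, y] + d.
  by exists ('[L x, L y] - '[x, y]); rewrite addrC subrK.
suff d0 : d = 0 by rewrite dE d0 addr0.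
have := inner_norm (L (x + d *: y)); rewrite (isometry_norm iL) -inner_norm.
rewrite linearD linearZ !innerDl !innerDr !innerZl !innerZr !inner_norm !(isometry_norm iL).
rewrite (innerC (L y)) (innerC y x).
rewrite dE rmorphD/=; set b := '[x, y]; set n := `|x| ^+ 2; set k := `|y| ^+ 2 => h.
have : d * d^* + d * d^* = 0.
  have -> : d * d^* + d * d^* =
    n + d^* * (b + d) + (d * (b^* + d^*) + d * (d^* * k)) -
    (n + d^* * b + (d * b^* + d * (d^* * k))) by ring.
  by rewrite h subrr.
by move/eqP; rewrite -mulr2n mulrn_eq0 /= mulf_eq0 conjc_eq0 orbb => /eqP.
Qed.

Lemma isometry_adjointK L x : isometry L -> adjoint L (L x) = x.
Proof.
move=> iL; apply: inner_inj => z.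
by rewrite -adjointE ?isometry_inner//; exact: isometry_contraction.
Qed.

(** The adjoint of a unitary is genuine: if no adjoint vector existed at [y], then
    [y] would be nonzero, and the default value [adjoint L y = 0] would contradict
    [L (adjoint L y) = y]. *)
Lemma unitary_isometry L : unitary L -> isometry L.
Proof.
move=> [_ _ KL LK] x _; split => //.
have adj u y : '[L u, y] = '[u, adjoint L y].
  rewrite /adjoint /adjoint_on; case: xgetP => [z _ [_ ->]//|h].
  have a0 : adjoint L y = 0.
    by rewrite /adjoint /adjoint_on; case: xgetP => // z _ zz; have := h z zz.
  by rewrite inner0r -(LK y I) -/(adjoint L y) a0 linear0 inner0r.
apply/eqP; rewrite -(@eqrXn2 _ 2)// -!inner_norm adj.
by rewrite [adjoint L _]KL.
Qed.

Lemma unitaryK L x : unitary L -> L (adjoint L x) = x.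
Proof. by move=> [_ _ _ LK]; exact: LK. Qed.

End Adjoints.

(** * Sums of orthogonal families of closed subspaces *)

Section HilbertSum.
#[local] Existing Instance totally_filter.
Context {R : realType} {H : hilbertType R}.
Implicit Types (x y z : H) (M N : set H).

Definition proj M x : H := xget 0 [set p | M p /\ forall v, M v -> '[x - p, v] = 0].

Lemma proj_unique M x p : closed_subspace M -> M p ->
  (forall v, M v -> '[x - p, v] = 0) -> proj M x = p.
Proof.
move=> cM Mp px; apply: xget_unique => // q [Mq qx].
have Mpq : M (q - p) by exact: subspaceB.
have := inner_norm (q - p).
rewrite -[X in inner X](subrKA x) -(opprB x q) innerDl px// addr0.
rewrite -scaleN1r innerZl qx// mulr0 => /esym/eqP.
by rewrite sqrf_eq0 normr_eq0 subr_eq0 => /eqP.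
Qed.

Section ClosedSubspace.
Variable M : set H.
Hypothesis cM : closed_subspace M.

Lemma projP x : M (proj M x) /\ forall v, M v -> '[x - proj M x, v] = 0.
Proof.
have [p Mp px] := orthogonal_projection x cM.
by rewrite (@proj_unique M x p).
Qed.

Lemma proj_linear (a : R[i]) x y : proj M (a *: x + y) = a *: proj M x + proj M y.
Proof.
have [Mx hx] := projP x; have [My hy] := projP y.
apply: proj_unique => //; first by apply: subspaceD => //; exact: subspaceZ.
move=> v Mv; rewrite opprD addrACA -scalerBr innerDl innerZl hx// hy//.
by rewrite mulr0 addr0.
Qed.

Lemma proj_id x : M x -> proj M x = x.
Proof. by move=> Mx; apply: proj_unique => // v; rewrite subrr inner0l. Qed.

Lemma proj_orthogonal x : (forall v, M v -> '[x, v] = 0) -> proj M x = 0.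
Proof.
by move=> xM; apply: proj_unique => // [|v]; [exact: subspace0|rewrite subr0; exact: xM].
Qed.

End ClosedSubspace.

Section Family.
Variables (I : choiceType) (M : I -> set H).
Hypothesis oM : orthogonal_family M.

(** The partial sums of the projections of [x] differ from [x] by an orthogonal
    projection of [x], hence by a contraction.  So the vectors that are the sum
    of their projections form a closed subspace. *)
Let residual (F : {fset I}) x := partial_sum (fun i => proj (M i) x) F - x.

Let residual_orthogonal F x j y : j \in F -> M j y -> '[residual F x, y] = 0.
Proof.
move=> jF Mjy; rewrite /residual /partial_sum (bigD1 [` jF]%fset)//= addrAC innerDl.
rewrite -opprB -scaleN1r innerZl (projP (oM.1 j) x).2// mulr0 add0r.
rewrite linear_sumlz big1// => -[i iF] /= ij.
apply: (oM.2 i j) Mjy; first by apply: contraNneq ij => /= e; apply/eqP/val_inj.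
exact: (projP (oM.1 i) x).1.
Qed.

Let residual_contraction F : contraction (residual F).
Proof.
split=> [a x y|x].
  rewrite /residual /partial_sum scalerBr addrACA -opprD; congr (_ - _).
  rewrite scaler_sumr -big_split /=; apply: eq_bigr => i _.
  exact: proj_linear (oM.1 _) _ _ _.
rewrite -ler_sqr ?nnegrE//.
have : '[- residual F x, partial_sum (fun i => proj (M i) x) F] = 0.
  rewrite -scaleN1r innerZl [X in _ * X]linear_sumr big1 ?mulr0// => i _.
  apply: (residual_orthogonal x (fsvalP i)); exact: (projP (oM.1 _) x).1.
by move=> /pythagoras; rewrite normrN /residual opprB subrK => ->; rewrite lerDl exprn_ge0.
Qed.

Let span := [set x | residual F x @[F --> totally] --> (0 : H)].

Let span_closed : closed_subspace span.
Proof. by apply: closed_subspace_cvg0; exact: residual_contraction. Qed.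

Let sub_span i : M i `<=` span.
Proof.
move=> x Mx; apply: norm_cvg => e e0; exists [fset i]%fset => // F /= iF.
have {}iF : i \in F by apply: (fsubsetP iF); rewrite inE.
rewrite subr0 /residual /partial_sum (bigD1 [` iF]%fset)//= (proj_id (oM.1 i))//.
rewrite big1 ?addr0 ?subrr ?normr0// => -[j jF] /= ji.
apply: proj_orthogonal (oM.1 j) _ _ => v.
by apply: (oM.2 i j) Mx; apply: contraNneq ji => e'; apply/eqP/val_inj.
Qed.

Lemma hilbert_sum_min N : closed_subspace N -> (forall i, M i `<=` N) ->
  hilbert_sum M `<=` N.
Proof.
move=> cN MN x [x_ [Mx xx]]; apply: (subspace_cvg cN xx).
by near=> F; apply: (subspace_sum cN) => i _; apply: MN (Mx _).
Unshelve. all: by end_near. Qed.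

Let hilbert_sumE : hilbert_sum M = span.
Proof.
apply/seteqP; split; first exact: hilbert_sum_min span_closed sub_span.
move=> x xs; exists (fun i => proj (M i) x); split => [i|].
  exact: (projP (oM.1 i) x).1.
exact/subr_cvg0.
Qed.

Lemma hilbert_sum_closed : closed_subspace (hilbert_sum M).
Proof. by rewrite hilbert_sumE. Qed.

Lemma sub_hilbert_sum i : M i `<=` hilbert_sum M.
Proof. by rewrite hilbert_sumE. Qed.

End Family.
End HilbertSum.

(** * The Wold decomposition of an isometry *)

Section Wold.
Context {R : realType} {H : hilbertType R}.
Implicit Types (x y z : H) (L : {linear H -> H}) (t : option nat) (G : set H).

(** The range of [L ^ m], as the set of fixed points of the projection
    [L ^ m (L ^ m)^*] onto it. *)
Definition range_iter L m : set H := [set x | iter m L (iter m (adjoint L) x) = x].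

Definition unitary_part L : set H := [set x | forall m, range_iter L m x].

Definition shift_part L : set H :=
  [set x | iter m (adjoint L) x @[m --> \oo] --> (0 : H)].

(** The pieces of the Wold decomposition: [level L (Some m)] is the image of
    [ker L^*] under [L ^ m], and [level L None] the unitary part. *)
Definition level L t : set H :=
  if t is Some m then [set x | range_iter L m x /\ iter m.+1 (adjoint L) x = 0]
  else unitary_part L.

Section OneIsometry.
Variable L : {linear H -> H}.
Hypothesis iL : isometry L.

Let cL : contraction L := isometry_contraction iL.
Let cL' : contraction (adjoint L) := adjoint_contraction cL.
Let cLm m : contraction (iter m L) := contraction_iter m cL.
Let cLm' m : contraction (iter m (adjoint L)) := contraction_iter m cL'.

Lemma iter_norm m x : `|iter m L x| = `|x|.
Proof. by elim: m => //= m <-; rewrite isometry_norm. Qed.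

Lemma iter_adjointK m x : iter m (adjoint L) (iter m L x) = x.
Proof. by elim: m x => // m IH x; rewrite iterSr iterS isometry_adjointK. Qed.

Lemma iter_adjointE m x y : '[iter m L x, y] = '[x, iter m (adjoint L) y].
Proof. by elim: m x => // m IH x; rewrite iterSr IH iterS adjointE. Qed.

Lemma range_iterP m x : range_iter L m x <-> exists y, x = iter m L y.
Proof.
split=> [<-|[y ->]]; first by exists (iter m (adjoint L) x).
by rewrite /range_iter /= iter_adjointK.
Qed.

Lemma range_iter_iter m x : range_iter L m (iter m L x).
Proof. by apply/range_iterP; exists x. Qed.

Lemma level_range t x : level L t x -> t != Some 0%N -> L (adjoint L x) = x.
Proof.
have ran1 m : range_iter L m.+1 x -> L (adjoint L x) = x.
  by move=> /range_iterP[y ->] /=; rewrite isometry_adjointK.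
by case: t => [[|m]|] //= xt _; [exact: ran1 xt.1|exact: (ran1 0%N)].
Qed.

Lemma closed_range_iter m : closed_subspace (range_iter L m).
Proof.
apply: (@closed_subspace_eq _ _ (iter m L \o iter m (adjoint L)) id) => //.
exact: contraction_comp.
Qed.

Lemma closed_unitary_part : closed_subspace (unitary_part L).
Proof. by apply: closed_subspaceI => m; exact: closed_range_iter. Qed.

Lemma closed_shift_part : closed_subspace (shift_part L).
Proof. exact: closed_subspace_cvg0 cLm'. Qed.

Lemma closed_level t : closed_subspace (level L t).
Proof.
case: t => [m|]; last exact: closed_unitary_part.
apply: closed_subspaceI2; first exact: closed_range_iter.
exact: closed_subspace_eq (cLm' m.+1) contraction_zero.
Qed.

Lemma level_sub_shift_part m : level L (Some m) `<=` shift_part L.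
Proof.
move=> x [_ x0]; apply: norm_cvg => e e0; exists m.+1 => // k /= mk.
by rewrite -(subnK mk) iterD x0 (contraction0 (cLm' _)) subrr normr0.
Qed.

(** [<x, y> = <(L ^ m)^* x, (L ^ m)^* y>] for [y] in the unitary part, and the
    right-hand side tends to [0]. *)
Lemma shift_orthogonal_unitary x y : shift_part L x -> unitary_part L y -> '[x, y] = 0.
Proof.
move=> xs yu; apply/eqP; rewrite -normr_le0; apply/ler_addgt0Pr => e e0; rewrite add0r.
have y0 : 0 < `|y| + 1 by rewrite ltr_wpDl.
have [m _ /(_ m (leqnn m))] := cvg_norm_lt xs (divr_gt0 e0 y0).
rewrite /= subr0 ltr_pdivlMr// => /ltW xm.
rewrite -(yu m) innerC iter_adjointE -innerC.
apply: le_trans (cauchy_schwarz _ _) _; apply: le_trans xm.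
by apply: ler_wpM2l => //; apply: le_trans ((cLm' m).2 _) _; rewrite lerDl.
Qed.

Lemma levels_orthogonal m m' x y : m != m' ->
  level L (Some m) x -> level L (Some m') y -> '[x, y] = 0.
Proof.
have lt_case k k' u v : (k < k')%N -> level L (Some k) u -> level L (Some k') v ->
    '[u, v] = 0.
  move=> kk' [_ u0] [<- _]; rewrite innerC iter_adjointE -innerC.
  by rewrite -{1}(subnK kk') iterD u0 (contraction0 (cLm' _)) inner0l.
rewrite neq_ltn => /orP[/lt_case h xm ym'|/lt_case h xm ym']; first exact: h.
by apply: inner_eq0C; exact: h.
Qed.

(** [L ^ m] shifts the levels by [m], and the unitary part onto itself. *)
Lemma level_iter m t x : level L t x -> level L (omap (addn m) t) (iter m L x).
Proof.
case: t => [a [/range_iterP[y ->] y0]|xu k] /=; last first.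
  apply/range_iterP; exists (iter m L (iter k (adjoint L) x)).
  by rewrite -iterD addnC iterD (xu k).
split; first by rewrite -iterD; exact: range_iter_iter.
by rewrite -iterS -addnS addnC iterD iter_adjointK.
Qed.

Lemma level_iter_inv m t x : level L (omap (addn m) t) x ->
  exists2 y, level L t y & x = iter m L y.
Proof.
case: t => [a [/range_iterP[y ->] y0]|xu] /=.
  exists (iter a L y); last by rewrite iterD.
  split; first exact: range_iter_iter.
  by move: y0; rewrite -iterS -addnS addnC !iterD iter_adjointK.
exists (iter m (adjoint L) x); last by rewrite xu.
move=> k; apply/range_iterP; exists (iter (m + k) (adjoint L) x).
by rewrite -[in LHS](xu (m + k)%N) iterD iter_adjointK.
Qed.

Lemma shift_part_reducing : reduces (shift_part L) L.
Proof.
move=> x xs; split.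
  rewrite /shift_part /= -(cvg_shiftn 1).
  rewrite (_ : (fun m => _) = (fun m => iter m (adjoint L) x))//.
  by apply: funext => m; rewrite addn1 iterSr isometry_adjointK.
rewrite /shift_part /= (_ : (fun m => _) = (fun m => iter (m + 1) (adjoint L) x)).
  by rewrite (cvg_shiftn 1 (fun m => iter m (adjoint L) x)).
by apply: funext => m; rewrite addn1 iterSr.
Qed.

Lemma unitary_part_reducing : reduces (unitary_part L) L.
Proof.
move=> x xu; split; first exact: (@level_iter 1 None).
by have [y yu ->] := @level_iter_inv 1 None _ xu; rewrite isometry_adjointK.
Qed.

(** With [xs] the projection of [x] onto the shift part, [x - xs] is orthogonal to
    every [L ^ m w] with [w] in [ker L^*].  Taking for [w] the component of
    [(L ^ m)^* (x - xs)] in [ker L^*] shows that this component vanishes. *)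
Lemma wold_decomposition x :
  exists2 xu, unitary_part L xu & shift_part L (x - xu).
Proof.
have [xs xss xsx] := orthogonal_projection x closed_shift_part.
exists (x - xs); last by rewrite opprB addrC subrK.
elim=> [//|m IH]; rewrite /range_iter /=.
set u := x - xs in xsx IH *; set y := iter m (adjoint L) u.
suff yr : L (adjoint L y) = y by rewrite -iterS iterSr yr.
apply/eqP; rewrite -subr_eq0 -opprB oppr_eq0 -normr_eq0 -sqrf_eq0 -inner_norm; apply/eqP.
set w := y - _.
have w0 : adjoint L w = 0 by rewrite /w (contractionB cL') isometry_adjointK// subrr.
have : level L (Some m) (iter m L w).
  rewrite -[m in Some m]addn0; apply: (@level_iter m (Some 0%N)); split => //.
move=> /level_sub_shift_part/xsx.
rewrite innerC iter_adjointE -innerC -/y => yw.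
by rewrite {1}/w innerBl yw sub0r adjointE// w0 inner0r oppr0.
Qed.

Lemma reducing_range_projection G x m : reduces G L -> G x ->
  G (iter m L (iter m (adjoint L) x)).
Proof.
move=> rG Gx; have : G (iter m (adjoint L) x) by elim: m => //= k /rG[].
by move: (iter _ _ x) => y Gy; elim: m => //= k /rG[].
Qed.

(** [xu] is the limit of the vectors [L ^ m (L ^ m)^* x], which stay in every
    subspace reducing [L]. *)
Lemma unitary_component_in G x xu : closed_subspace G -> reduces G L ->
  unitary_part L xu -> shift_part L (x - xu) -> G x -> G xu.
Proof.
move=> cG rG xuu xs Gx.
have Gm m : G (iter m L (iter m (adjoint L) x)) by exact: reducing_range_projection.
apply: subspace_approx => // e /(cvg_norm_lt xs)[m _ /(_ m (leqnn m))].
rewrite /= subr0 => xm; exists (iter m L (iter m (adjoint L) x)) => //.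
rewrite -[in X in X - _](xuu m) -(contractionB (cLm _)) -(contractionB (cLm' _)).
by rewrite iter_norm -opprB (contractionN (cLm' _)) normrN.
Qed.

(** A vector of the shift part is the limit of [x - L ^ m (L ^ m)^* x], the sum of
    its components in the levels below [m]. *)
Lemma shift_part_levels G x : closed_subspace G -> shift_part L x ->
  (forall m, G (iter m L (iter m (adjoint L) x) -
                iter m.+1 L (iter m.+1 (adjoint L) x))) -> G x.
Proof.
move=> cG xs Gx; apply: subspace_approx => // e /(cvg_norm_lt xs)[m _ /(_ m (leqnn m))].
rewrite /= subr0 -(iter_norm m) => xm.
exists (x - iter m L (iter m (adjoint L) x)); last by rewrite opprB addrC subrK.
elim: m {xm} => [|m IH]; first by rewrite subrr; exact: subspace0.
have := subspaceD cG IH (Gx m); rewrite addrA subrK; exact.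
Qed.

Lemma level_component m x :
  level L (Some m) (iter m L (iter m (adjoint L) x) -
                    iter m.+1 L (iter m.+1 (adjoint L) x)).
Proof.
rewrite iterSr [iter m.+1 _ x]iterS; set y := iter m (adjoint L) x.
rewrite -(contractionB (cLm m)) -[m in Some m]addn0.
apply: (@level_iter m (Some 0%N)); split => //=.
by rewrite (contractionB cL') isometry_adjointK// subrr.
Qed.

End OneIsometry.
End Wold.

(** * Twisted isometries preserve each other's decompositions *)

Section Compatibility.
Context {R : realType} {H : hilbertType R}.
Implicit Types (x y z : H) (L : {linear H -> H}) (S T C D : H -> H) (G : set H).

Lemma adjointK T : contraction T -> adjoint (adjoint T) =1 T.
Proof.
move=> cT y; apply: inner_inj => x.
by rewrite -adjointE ?adjointEr//; exact: adjoint_contraction.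
Qed.

Lemma adjoint_commute S T : contraction S -> contraction T ->
  S \o T =1 T \o S -> adjoint S \o adjoint T =1 adjoint T \o adjoint S.
Proof.
move=> cS cT ST x; apply: inner_inj => y /=.
by rewrite -!adjointE//; have /= -> := ST y.
Qed.

(** The part of commuting with [L] and [L^*] that survives a twist, and that is
    enough to preserve the two parts and the levels of [L]. *)
Definition compatible L T :=
  (forall m x, range_iter L m x -> range_iter L m (T x)) /\
  (forall m x, `|iter m (adjoint L) (T x)| <= `|iter m (adjoint L) x|).

(** A factor [C] commuting with [L] does not lead out of the range of [L ^ m], and
    a contraction [D] commuting with [L^*] does not increase [|(L ^ m)^* x|]. *)
Lemma compatible_of_twist L T C D : isometry L -> contraction T -> contraction D ->
  L \o C =1 C \o L -> T \o L =1 C \o L \o T ->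
  adjoint L \o D =1 D \o adjoint L -> adjoint L \o T =1 D \o T \o adjoint L ->
  compatible L T.
Proof.
move=> iL [_ cT] [_ cD] LC TL LD LT; split.
  elim=> [//|m IH] x /(range_iterP iL)[y ->]; apply/(range_iterP iL).
  have /IH/(range_iterP iL)[z ez] := range_iter_iter iL m y.
  exists (C z); rewrite iterS [LHS]TL /= ez.
  elim: (m) => [|k IHk] /=; first by rewrite [RHS]LC.
  by rewrite -IHk [RHS]LC.
have LmD m y : iter m (adjoint L) (D y) = D (iter m (adjoint L) y).
  by elim: m => // m IH; rewrite iterS IH [LHS]LD.
elim=> [|m IH] x; first exact: cT.
rewrite !iterSr; have /= -> := LT x; rewrite LmD.
exact: le_trans (cD _) (IH _).
Qed.

Lemma compatible_shift_part L T x : compatible L T -> shift_part L x ->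
  shift_part L (T x).
Proof.
move=> [_ LT] xs; apply: norm_cvg => e e0.
have [m _ xm] := cvg_norm_lt xs e0; exists m => // k /xm /=; rewrite !subr0.
exact: le_lt_trans.
Qed.

Lemma compatible_level L T t x : compatible L T -> level L t x -> level L t (T x).
Proof.
move=> [rT nT]; case: t => [m [/rT xr x0]|xu m]; last exact: rT.
split=> //; apply/eqP; rewrite -normr_eq0 eq_le normr_ge0 andbT.
by apply: le_trans (nT _ _) _; rewrite x0 normr0.
Qed.

Lemma compatible_iter L T m : compatible L T -> compatible L (iter m T).
Proof.
move=> [rT nT]; split=> k x; first by move=> xk; elim: m => //= m; exact: rT.
by elim: m => // m; apply: le_trans (nT _ _).
Qed.

End Compatibility.

Section TwistedTuple.
Context {R : realType} {H : hilbertType R} {n : nat}.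
Variables (U : 'I_n -> 'I_n -> {linear H -> H}) (V : 'I_n -> {linear H -> H}).
Hypothesis UV : twisted_isometry_wrt U V.
Implicit Types (i j : 'I_n) (x y : H).

Let iV i : isometry (V i). Proof. by have [_ _] := UV. Qed.
Let cV i : contraction (V i). Proof. exact: isometry_contraction. Qed.
Let cV' i : contraction (adjoint (V i)). Proof. exact: adjoint_contraction. Qed.

Let unitary_facts (L : {linear H -> H}) : unitary L ->
  [/\ contraction L, adjoint L \o L =1 id & L \o adjoint L =1 id].
Proof.
move=> uL; have iL := unitary_isometry uL; split; first exact: isometry_contraction.
  by move=> x; exact: isometry_adjointK.
by move=> x; exact: unitaryK.
Qed.

Let twist_unitary i j : i != j ->
  [/\ contraction (twist U i j), adjoint (twist U i j) \o twist U i j =1 id &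
      twist U i j \o adjoint (twist U i j) =1 id].
Proof.
rewrite /twist; have [uU _ _ _ _] := UV.
rewrite -(inj_eq val_inj) neq_ltn => /orP[ij|ji].
  by rewrite ij; exact: unitary_facts (uU _ _ ij).
rewrite ltnNge ltnW//=; have [cU KU UK] := unitary_facts (uU _ _ ji).
split=> [|x|x]; first exact: adjoint_contraction.
  by rewrite /= adjointK//; exact: UK.
by rewrite /= adjointK//; exact: KU.
Qed.

Let twist_commute i j k : i != j -> V k \o twist U i j =1 twist U i j \o V k.
Proof. by have [_ _ _ _] := UV; apply. Qed.

Let twist'_commute i j k : i != j ->
  V k \o adjoint (twist U i j) =1 adjoint (twist U i j) \o V k.
Proof.
move=> ij x; have [_ K1 K2] := twist_unitary ij.
rewrite -[LHS]K1 /= -[twist U i j (V k _)]twist_commute//=.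
by congr (adjoint _ (V k _)); exact: K2.
Qed.

Let adjoint_twist'_commute i j k : i != j ->
  adjoint (V k) \o adjoint (twist U i j) =1 adjoint (twist U i j) \o adjoint (V k).
Proof.
by move=> ij; apply: adjoint_commute => //; [case: (twist_unitary ij)|exact: twist_commute].
Qed.

Let adjoint_twist_commute i j k : i != j ->
  adjoint (V k) \o twist U i j =1 twist U i j \o adjoint (V k).
Proof.
move=> ij x; have [cW _ _] := twist_unitary ij.
have := adjoint_commute (cV k) (adjoint_contraction cW) (twist'_commute k ij) x.
by rewrite /= !adjointK.
Qed.

Let twisted_adjoint i j : i != j ->
  adjoint (V i) \o V j =1 adjoint (twist U i j) \o V j \o adjoint (V i).
Proof. by have [_ _ _ h _] := UV; exact: h. Qed.

(** [V_i V_j = U_ij V_j V_i] follows from the relation between [V_i^*] and [V_j]: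
    both sides have the norm of [x], and that relation makes their inner
    product equal to [|x| ^ 2]. *)
Lemma twisted_product i j : i != j -> V i \o V j =1 twist U i j \o V j \o V i.
Proof.
move=> ij x /=; have [cW K1 K2] := twist_unitary ij.
set a := V i (V j x); set b := twist U i j _.
have na : `|a| = `|x| by rewrite /a !isometry_norm.
have nb : `|b| <= `|x| by apply: le_trans (cW.2 _) _; rewrite !isometry_norm.
have ab : '[a, b] = `|x| ^+ 2.
  rewrite /a adjointE// /b.
  have /= -> := adjoint_twist_commute i ij (V j (V i x)).
  have /= -> := twisted_adjoint ij (V i x).
  have /= -> := K2 (V j (adjoint (V i) (V i x))).
  by rewrite isometry_adjointK// inner_norm isometry_norm.
apply/eqP; rewrite -subr_eq0 -normr_le0 -(@ler_pXn2r _ 2)// ?nnegrE// expr0n /=.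
rewrite -inner_norm innerBl !innerBr !inner_norm ab (innerC b) ab na.
rewrite (CrealP (ger0_real _)) ?exprn_ge0//.
by rewrite subrr sub0r opprB subr_le0 ler_pXn2r ?nnegrE.
Qed.

Lemma compatible_isometry i j : i != j -> compatible (V i) (V j).
Proof.
move=> ij; have ji : j != i by rewrite eq_sym.
have [cW _ _] := twist_unitary ij.
apply: (@compatible_of_twist _ _ _ _ (twist U j i) (adjoint (twist U i j))) => //.
- exact: adjoint_contraction.
- exact: twist_commute.
- exact: twisted_product.
- exact: adjoint_twist'_commute.
- exact: twisted_adjoint.
Qed.

Lemma compatible_adjoint i j : i != j -> compatible (V i) (adjoint (V j)).
Proof.
move=> ij; have ji : j != i by rewrite eq_sym.
have [cW _ _] := twist_unitary ji.
apply: (@compatible_of_twist _ _ _ _ (adjoint (twist U j i)) (adjoint (twist U j i))) => //.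
- exact: adjoint_contraction.
- exact: twist'_commute.
- exact: twisted_adjoint.
- exact: adjoint_twist'_commute.
move=> x; apply: inner_inj => y /=.
rewrite -!adjointE//; have /= -> := twisted_product ji y.
have /= <- := twist_commute i ji (V j y).
by have /= <- := twist_commute j ji y.
Qed.

End TwistedTuple.

(** * The decomposition of a twisted tuple *)

Section JointLevels.
Context {R : realType} {H : hilbertType R} {n : nat}.
Variable V : 'I_n -> {linear H -> H}.
Hypothesis twV : twisted_isometry V.
Implicit Types (i j : 'I_n) (x y : H) (A : {set 'I_n}) (tau : 'I_n -> option nat).

Let iV i : isometry (V i). Proof. by have [U [_ _]] := twV. Qed.
Let cV i : contraction (V i). Proof. exact: isometry_contraction. Qed.
Let cpV i j : i != j -> compatible (V i) (V j).
Proof. by have [U UV] := twV; exact: (compatible_isometry UV). Qed.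
Let cpV' i j : i != j -> compatible (V i) (adjoint (V j)).
Proof. by have [U UV] := twV; exact: (compatible_adjoint UV). Qed.

Definition joint_level tau : set H := [set x | forall i, level (V i) (tau i) x].

(** [V i ^ m] raises the level at [i] by [m] and, being compatible with the other
    isometries, leaves the remaining levels unchanged. *)
Lemma joint_level_iter tau i m :
  iter m (V i) @` joint_level tau =
  joint_level (fun j => omap (addn (if i == j then m else 0)) (tau j)).
Proof.
have omap0 t : omap (addn 0) t = t by case: t.
apply/seteqP; split=> [_ [x xt <-] j|x xt].
  have [<-|ij] := eqVneq i j; first exact: (level_iter (iV i) m (xt i)).
  rewrite omap0; apply: compatible_level (xt j).
  by apply: compatible_iter; apply: cpV; rewrite eq_sym.
have := xt i; rewrite eqxx => /(level_iter_inv (iV i))[y yt xy].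
exists y; last exact: esym.
move=> j; have [<-//|ij] := eqVneq i j.
have := xt j; rewrite (negbTE ij) omap0 => xtj.
rewrite -(iter_adjointK (iV i) m y) -xy; apply: compatible_level xtj.
by apply: compatible_iter; apply: cpV'; rewrite eq_sym.
Qed.

Section Monomials.
Variables (J : Type) (r : seq J) (g : J -> 'I_n) (k : J -> nat).

Lemma joint_level_monomial tau :
  (\big[comp/id]_(j <- r) iter (k j) (V (g j))) @` joint_level tau =
  joint_level (fun i => omap (addn (\sum_(j <- r | g j == i) k j)) (tau i)).
Proof.
elim: r => [|j s IH].
  rewrite big_nil image_id; congr joint_level; apply: funext => i.
  by rewrite big_nil; case: (tau i).
rewrite big_cons -image_comp IH joint_level_iter; congr joint_level.
apply: funext => i; rewrite big_cons; case: (tau i) => //= a.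
by case: ifP => _; rewrite ?addnA.
Qed.

Lemma monomial_range i x :
  range_iter (V i) (\sum_(j <- r | g j == i) k j)
    ((\big[comp/id]_(j <- r) iter (k j) (V (g j))) x).
Proof.
elim: r => [|j s IH]; first by rewrite !big_nil.
rewrite !big_cons /=; case: eqVneq => [->|ji].
  have /(range_iterP (iV i))[y ->] := IH.
  by rewrite -iterD; exact: range_iter_iter.
by apply: (compatible_iter _ (cpV _)).1 IH; rewrite eq_sym.
Qed.

End Monomials.

(** [k] is indexed by the positions in [enum A]; this is the same multi-index as a
    function on all of ['I_n], extended by zero. *)
Definition exponent A (k : {ffun 'I_#|A| -> nat}) i : nat :=
  \sum_(j < #|A| | enum_val j == i) k j.

Lemma exponent_enum_val A (k : {ffun 'I_#|A| -> nat}) (j : 'I_#|A|) :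
  exponent k (enum_val j) = k j.
Proof. by rewrite /exponent (big_pred1 j)// => l; rewrite (inj_eq enum_val_inj). Qed.

Lemma exponent_notin A (k : {ffun 'I_#|A| -> nat}) i : i \notin A -> exponent k i = 0%N.
Proof.
move=> iA; rewrite /exponent big1// => j /eqP ji.
by rewrite -ji enum_valP in iA.
Qed.

Lemma in_enum_val A i : i \in A -> exists j : 'I_#|A|, i = enum_val j.
Proof. by move=> iA; exists (enum_rank_in iA i); rewrite enum_rankK_in. Qed.

Definition summand_level A (k : {ffun 'I_#|A| -> nat}) i : option nat :=
  if i \in A then Some (exponent k i) else None.

Lemma wanderingE A x : wandering V A x <-> forall i, i \in A -> level (V i) (Some 0%N) x.
Proof. by split=> [h i /h|h i /h[]]. Qed.

(** The isometries indexed outside [A] map this joint level onto itself, which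
    gives one inclusion.  For the other, the exponents all equal to [m] show that
    [x] is in the range of [V i ^ m] for each [i] outside [A]. *)
Lemma wandering_core A :
  \bigcap_(l in [set: {ffun 'I_#|~: A| -> nat}]) (mpow V l @` wandering V A) =
  joint_level (fun i => if i \in A then Some 0%N else None).
Proof.
apply/seteqP; split=> [x xA i|x xA l _].
  case: ifPn => iA.
    have mpow0 : mpow V [ffun=> 0%N] =1 id :> (H -> H).
      move=> z; rewrite /mpow; elim: (index_enum _) => [|j s IH]; first by rewrite big_nil.
      by rewrite big_cons ffunE; exact: IH.
    have [y yA <-] := xA [ffun=> 0%N] I; rewrite mpow0.
    exact: (wanderingE A y).1 yA i iA.
  move=> m; have [y yA <-] := xA [ffun=> m] I.
  have /in_enum_val[j ij] : i \in ~: A by rewrite inE.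
  have e : exponent ([ffun=> m] : {ffun 'I_#|~: A| -> nat}) i = m.
    by rewrite ij exponent_enum_val ffunE.
  by rewrite -{1}e; exact: monomial_range.
suff [y yA <-] : (mpow V l @` joint_level (fun i => if i \in A then Some 0%N else None)) x.
  exists y => //; apply/wanderingE => i iA.
  by have := yA i; rewrite iA.
rewrite joint_level_monomial => i; have := xA i; case: ifPn => //= iA.
by rewrite -/(exponent l i) exponent_notin// inE iA.
Qed.

Lemma summandE A (k : {ffun 'I_#|A| -> nat}) :
  summand V k = joint_level (summand_level k).
Proof.
rewrite /summand wandering_core joint_level_monomial; congr joint_level.
by apply: funext => i; rewrite /summand_level; case: ifP => //=; rewrite addn0.
Qed.

Lemma orthogonal_summands A : orthogonal_family (summand V (A := A)).
Proof.
split=> [k|k k' kk' x y].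
  by rewrite summandE; apply: closed_subspaceI => i; exact: closed_level.
rewrite !summandE => xk yk'.
have [j kj] : exists j : 'I_#|A|, k j != k' j.
  by apply/existsP; apply: contraNT kk'; rewrite negb_exists => /forallP h;
    apply/eqP/ffunP => j; apply/eqP; have := h j; rewrite negbK.
have := xk (enum_val j); have := yk' (enum_val j).
rewrite /summand_level enum_valP !exponent_enum_val => yj xj.
exact: (levels_orthogonal (iV _) kj xj yj).
Qed.

Definition wold_part A : set H := [set x | forall i,
  (if i \in A then shift_part (V i) else unitary_part (V i)) x].

Lemma closed_wold_part A : closed_subspace (wold_part A).
Proof.
apply: closed_subspaceI => i.
by case: ifP => _; [exact: closed_shift_part|exact: closed_unitary_part].
Qed.

Lemma shift_part_reduces i j : reduces (shift_part (V i)) (V j).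
Proof.
have [<-|ij] := eqVneq i j; first exact: shift_part_reducing.
by move=> x xs; split; apply: compatible_shift_part => //; [exact: cpV|exact: cpV'].
Qed.

Lemma unitary_part_reduces i j : reduces (unitary_part (V i)) (V j).
Proof.
have [<-|ij] := eqVneq i j; first exact: unitary_part_reducing.
by move=> x xu; split; apply: (@compatible_level _ _ _ _ None) => //; [exact: cpV|exact: cpV'].
Qed.

Lemma wold_part_reduces A j : reduces (wold_part A) (V j).
Proof.
move=> x xA; split=> i; have := xA i; case: ifP => _ xi.
- by have [] := shift_part_reduces j xi.
- by have [] := unitary_part_reduces j xi.
- by have [] := shift_part_reduces j xi.
- by have [] := unitary_part_reduces j xi.
Qed.

Lemma summand_sub_wold_part A (k : {ffun 'I_#|A| -> nat}) : summand V k `<=` wold_part A.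
Proof.
rewrite summandE => x xk i; have := xk i; rewrite /summand_level; case: ifP => // _.
exact: level_sub_shift_part.
Qed.

(** Each summand satisfies the conditions defining [wold_part A].  Conversely,
    induction on the list [s] of the indices at which the level of [x] is still
    unknown: at an index of [A], [x] is a limit of sums of its components in the
    levels there, each of which has one unknown level less. *)
Lemma HAE A : HA V A = wold_part A.
Proof.
have oA := orthogonal_summands A; have cH : closed_subspace (HA V A).
  exact: hilbert_sum_closed oA.
apply/seteqP; split.
  exact: hilbert_sum_min (closed_wold_part A) (@summand_sub_wold_part A).
suff all_s (s : seq 'I_n) x : wold_part A x ->
    (forall i, i \in A -> i \notin s -> exists m, level (V i) (Some m) x) -> HA V A x.
  by move=> x xA; apply: (all_s (enum 'I_n)) => // i _; rewrite mem_enum.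
elim: s x => [|i s IH] x xA xs.
  have /choice[m xm] i : exists m, i \in A -> level (V i) (Some m) x.
    have [iA|_] := boolP (i \in A); last by exists 0%N.
    by have [m xm] := xs i iA isT; exists m.
  apply: (sub_hilbert_sum oA (i := [ffun j => m (enum_val j)])).
  rewrite summandE => i; have := xA i; rewrite /summand_level; case: ifP => // iA _.
  have [j ij] := in_enum_val iA.
  by rewrite ij exponent_enum_val ffunE -ij; exact: xm.
have [iA|iA] := boolP (i \in A); last first.
  apply: IH => // j jA js; apply: xs => //; rewrite inE negb_or js andbT.
  by apply: contraTneq jA => ->.
have := xA i; rewrite iA => /(shift_part_levels (iV i) cH); apply => m.
have in_reducing G : closed_subspace G -> reduces G (V i) -> G x ->
    G (iter m (V i) (iter m (adjoint (V i)) x) -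
       iter m.+1 (V i) (iter m.+1 (adjoint (V i)) x)).
  by move=> cG rG Gx; apply: subspaceB => //; exact: reducing_range_projection.
apply: IH => [|j jA js].
  by apply: in_reducing xA; [exact: closed_wold_part|exact: wold_part_reduces].
have [->|ji] := eqVneq j i; first by exists m; exact: level_component.
have [k xk] : exists k, level (V j) (Some k) x by apply: xs => //; rewrite inE negb_or ji.
exists k; apply: in_reducing xk; first exact: closed_level.
by move=> y yk; split; apply: compatible_level yk; [exact: cpV|exact: cpV'].
Qed.

Lemma orthogonal_HA : orthogonal_family (HA V).
Proof.
split=> [A|A B AB x y]; first by rewrite HAE; exact: closed_wold_part.
rewrite !HAE => xA yB.
have [i iAB] : exists i, (i \in A) != (i \in B).
  by apply/existsP; apply: contraNT AB; rewrite negb_exists => /forallP h;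
    apply/eqP/setP => i; apply/eqP; have := h i; rewrite negbK.
have := xA i; have := yB i; move: iAB; case: ifP => iB; case: ifP => iA // _ yi xi.
  apply: inner_eq0C; exact: (shift_orthogonal_unitary (iV i)) yi xi.
exact: (shift_orthogonal_unitary (iV i)) xi yi.
Qed.

(** Induction on the list [s] of the indices at which [x] may lie neither in the
    shift part nor in the unitary part: [x] is split at one of them, and both
    components keep their place at the other indices. *)
Lemma hilbert_sum_HA : hilbert_sum (HA V) = setT.
Proof.
have oH := orthogonal_HA; have cH := hilbert_sum_closed oH.
suff all_s (s : seq 'I_n) x :
    (forall i, i \notin s -> shift_part (V i) x \/ unitary_part (V i) x) ->
    hilbert_sum (HA V) x.
  apply/seteqP; split=> // x _; apply: (all_s (enum 'I_n)) => i.
  by rewrite mem_enum.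
elim: s x => [|i s IH] x xs.
  apply: (sub_hilbert_sum oH (i := [set i | `[< shift_part (V i) x >]]%SET)).
  rewrite HAE => i; rewrite inE; case: asboolP => // nxs.
  by have [] := xs i isT.
have [xu xuu xss] := wold_decomposition (iV i) x.
have in_reducing G : closed_subspace G -> reduces G (V i) -> G x -> G xu /\ G (x - xu).
  move=> cG rG Gx; have Gxu := unitary_component_in (iV i) cG rG xuu xss Gx.
  by split=> //; exact: subspaceB.
have xsj j : j != i -> j \notin s ->
    (shift_part (V j) xu \/ unitary_part (V j) xu) /\
    (shift_part (V j) (x - xu) \/ unitary_part (V j) (x - xu)).
  move=> ji js; have [|xj|xj] := xs j; first by rewrite inE negb_or ji.
    have [|||? ?] := in_reducing (shift_part (V j)); first exact: closed_shift_part.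
    - exact: shift_part_reduces.
    - exact: xj.
    - by split; left.
  have [|||? ?] := in_reducing (unitary_part (V j)); first exact: closed_unitary_part.
  - exact: unitary_part_reduces.
  - exact: xj.
  - by split; right.
rewrite -(subrK xu x); apply: subspaceD => //; apply: IH => j js.
  by have [->|ji] := eqVneq j i; [left|exact: (xsj j ji js).2].
by have [->|ji] := eqVneq j i; [right|exact: (xsj j ji js).1].
Qed.

Lemma shift_on_HA A i : i \in A -> shift_on (HA V A) (V i).
Proof.
move=> iA; have rA : reduces (HA V A) (V i) by rewrite HAE; exact: wold_part_reduces.
split=> [x /rA[Vx _]|x xA]; first by rewrite (isometry_norm (iV i)).
have -> : (fun m => iter m (adjoint_on (HA V A) (V i)) x) =
          (fun m => iter m (adjoint (V i)) x).
  apply: funext => m.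
  suff [] : iter m (adjoint_on (HA V A) (V i)) x = iter m (adjoint (V i)) x /\
            HA V A (iter m (adjoint (V i)) x) by [].
  elim: m => // m [IH xm] /=; rewrite IH; split; last by have [] := rA _ xm.
  exact: adjoint_on_reducing.
by move: xA; rewrite HAE => /(_ i); rewrite iA.
Qed.

Lemma unitary_on_HA A j : j \notin A -> unitary_on (HA V A) (V j).
Proof.
move=> jA; have rA : reduces (HA V A) (V j) by rewrite HAE; exact: wold_part_reduces.
split=> [x /rA[]//||x xA|x xA].
- apply: continuous_subspaceT => x; apply/cvgrPdist_lt => e e0.
  near=> y; rewrite -linearB (isometry_norm (iV j)); near: y.
  exact: cvgr_dist_lt.
- rewrite adjoint_on_reducing ?isometry_adjointK//; by have [] := rA _ xA.
rewrite adjoint_on_reducing//; move: xA; rewrite HAE => /(_ j); rewrite (negbTE jA).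
by move=> xu; exact: (@level_range _ _ _ (iV j) None).
Unshelve. all: by end_near. Qed.

End JointLevels.

Theorem theorem3p6 (R : realType) (H : hilbertType R) (n : nat)
    (V : 'I_n -> {linear H -> H}) :
  separable H -> (2 <= n)%N -> twisted_isometry V ->
  [/\ forall A : {set 'I_n}, orthogonal_family (summand V (A := A)),
      forall A : {set 'I_n}, closed_subspace (HA V A) /\
        forall i : 'I_n, reduces (HA V A) (V i),
      orthogonal_family (HA V) /\ hilbert_sum (HA V) = [set: H]%classic &
      forall A : {set 'I_n},
        (forall i, i \in A -> shift_on (HA V A) (V i)) /\
        (forall j, j \in ~: A -> unitary_on (HA V A) (V j))].
Proof.
move=> _ _ twV; split=> [A|A||A].
- exact: orthogonal_summands.
- by rewrite HAE//; split=> [|i]; [exact: closed_wold_part|exact: wold_part_reduces].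
- by split; [exact: orthogonal_HA|exact: hilbert_sum_HA].
- by split=> i; [exact: shift_on_HA|rewrite inE; exact: unitary_on_HA].
Qed.
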